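(* Let $S$ be a finite $G$-set with orbit set $\mathcal{O}=\mathcal{O}(S)=\{o_1,\dots,o_k\}$. Define $\pi_n:\mathcal{D}_n(G,S)\to\Pi_n(\mathcal{O})$ by sending $(\tilde\beta,z)$, with $\beta=\{B_1,\dots,B_\ell\}$ ordered so that $|B_1|\geq\cdots\geq|B_\ell|$, to the $\mathcal{O}$-labeled partition $(|B_1|,\dots,|B_\ell|\,\|\,|z^{-1}(o_1)|_{o_1},\dots,|z^{-1}(o_k)|_{o_k})$. Then $\pi_n$ is surjective and its fibers are exactly the $\Sigma_n[G]$-orbits of $\mathcal{D}_n(G,S)$; hence the $\Sigma_n[G]$-orbits of $\mathcal{D}_n(G,S)$ are in bijection with the $\mathcal{O}$-labeled partitions of $n$.
   Context: $G$ is a finite group acting on a finite set $S$, $n\geq1$. A projectivized $G$-coloring of a finite set $B$ is an equivalence class of functions $b:B\to G$ with $b\sim bg$ for $g\in G$. A partial $G$-partition $\tilde\beta$ of $[n]$ is a partition $\beta$ of a subset of $[n]$ into nonempty blocks each with a projectivized $G$-coloring; its zero block is $Z=[n]\setminus\bigcup_{B\in\beta}B$. $\mathcal{D}_n(G,S)$ is the set of pairs $(\tilde\beta,z)$ with $z:Z\to S$. The wreath product $\Sigma_n[G]=G^n\rtimes\Sigma_n$ acts: $(g_1,\dots,g_n,\sigma)$ sends $(\tilde\beta,z)$ to the pair with blocks $\sigma(B)$ colored by $b'(\sigma(j))=g_jb(j)$ and zero block $\sigma(Z)$ colored by $z'(\sigma(j))=g_j.z(j)$. An $\mathcal{O}$-labeled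 partition of $n$ is a tuple $(\lambda_1,\dots,\lambda_\ell\,\|\,\lambda_{o_1},\dots,\lambda_{o_k})$ of integers with $\lambda_1\geq\cdots\geq\lambda_\ell>0$ (unlabeled parts), $\lambda_{o_j}\geq0$ (labeled parts, each label used once) and $\sum\lambda_i+\sum\lambda_{o_j}=n$; $\Pi_n(\mathcal{O})$ denotes the set of these. *)

(* Defs.v *)
From HB Require Import structures.
From mathcomp Require Import all_boot all_fingroup.

Set Implicit Arguments.
Unset Strict Implicit.
Unset Printing Implicit Defensive.

Local Open Scope group_scope.

(* The actions of MathComp are right actions, whereas G and the wreath product
   act here on the left. A left action is converted by x . a := a^-1 . x, which
   does not change the orbits. *)
Record left_action (gT : finGroupType) (T : Type) := LeftAction {
  lact :> gT -> T -> T;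
  lact1 : forall x, lact 1 x = x;
  lactM : forall a b x, lact (a * b) x = lact a (lact b x) }.

Section RightOfLeft.
Variables (gT : finGroupType) (T : Type) (A : left_action gT T).

Definition right_act (x : T) (a : gT) : T := A a^-1 x.

Lemma right_act1 : right_act^~ 1 =1 id.
Proof. by move=> x; rewrite /right_act invg1 lact1. Qed.

Lemma right_actM x : act_morph right_act x.
Proof. by move=> a b; rewrite /right_act invMg lactM. Qed.

Definition right_of_left : {action gT &-> T} :=
  TotalAction right_act1 right_actM.

End RightOfLeft.

Section Orbits.
Variables (gT : finGroupType) (T : finType).

Definition orbits (to : {action gT &-> T}) : {set {set T}} :=
  [set orbit to [set: gT] x | x : T].

Definition lorbits (A : left_action gT T) : {set {set T}} :=
  orbits (right_of_left A).

Definition orbit_type (A : left_action gT T) : finType :=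
  {o : {set T} | o \in lorbits A}.

Lemma lorbitP (A : left_action gT T) (x y : T) :
  reflect (exists a : gT, A a x = y)
          (y \in orbit (right_of_left A) [set: gT] x).
Proof.
apply: (iffP imsetP) => [[a _ ->] | [a <-]]; first by exists a^-1.
by exists a^-1; rewrite ?inE //= /right_act invgK.
Qed.

End Orbits.

Definition mulg_laction (gT : finGroupType) : left_action gT gT :=
  LeftAction (@mul1g gT) (fun a b x => esym (mulgA a b x)).

(* The wreath product G^n ><| Sigma_n, whose law
     (h, t) (g, s) = ((h_{s(j)} g_j)_j, t o s)
   is the composition of the maps by which its elements act below; the product
   of permutations in MathComp is diagrammatic, so that t o s is s * t. *)
Record wreath (n : nat) (gT : finGroupType) := Wreath {
  wcoord : {ffun 'I_n -> gT};
  wperm : 'S_n }.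

Section WreathGroup.
Variables (n : nat) (gT : finGroupType).
Implicit Types w : wreath n gT.

Definition wreath_pair w := (wcoord w, wperm w).
Definition wreath_of (p : {ffun 'I_n -> gT} * 'S_n) := Wreath p.1 p.2.

Lemma wreath_pairK : cancel wreath_pair wreath_of.
Proof. by case. Qed.

HB.instance Definition _ :=
  Finite.copy (wreath n gT) (can_type wreath_pairK).

Definition wreath_mul v w : wreath n gT :=
  Wreath [ffun j => wcoord v (wperm w j) * wcoord w j] (wperm w * wperm v).

Definition wreath_one : wreath n gT := Wreath [ffun=> 1] 1.

Definition wreath_inv w : wreath n gT :=
  Wreath [ffun i => (wcoord w ((wperm w)^-1 i))^-1] (wperm w)^-1.

Lemma wreath_mulA : associative wreath_mul.
Proof.
move=> u v w; congr Wreath; rewrite /= ?mulgA //.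
by apply/ffunP=> j; rewrite !ffunE /= permM mulgA.
Qed.

Lemma wreath_mul1 : left_id wreath_one wreath_mul.
Proof.
case=> g s; congr Wreath; rewrite /= ?mulg1 //.
by apply/ffunP=> j; rewrite !ffunE mul1g.
Qed.

Lemma wreath_mulV : left_inverse wreath_one wreath_inv wreath_mul.
Proof.
case=> g s; congr Wreath; rewrite /= ?mulgV //.
by apply/ffunP=> j; rewrite !ffunE /= permK mulVg.
Qed.

HB.instance Definition _ := Finite_isGroup.Build (wreath n gT)
  wreath_mulA wreath_mul1 wreath_mulV.

Lemma wpermM v w : wperm (v * w) = wperm w * wperm v.
Proof. by []. Qed.

Lemma wcoordM v w j :
  wcoord (v * w) j = wcoord v (wperm w j) * wcoord w j.
Proof. by rewrite ffunE. Qed.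

End WreathGroup.

(* A function from a subset of [n] to T is encoded by a total function to
   option T, which is Some exactly on that subset. *)
Definition pfun (n : nat) (T : finType) : finType := {ffun 'I_n -> option T}.

Definition pdom (n : nat) (T : finType) (f : pfun n T) : {set 'I_n} :=
  [set j | isSome (f j)].

Definition ppreim (n : nat) (T : finType) (f : pfun n T) (o : {set T}) :
    {set 'I_n} :=
  [set j | if f j is Some x then x \in o else false].

Section WreathPfun.
Variables (n : nat) (gT : finGroupType) (T : finType) (A : left_action gT T).
Implicit Types (w : wreath n gT) (f : pfun n T).

Definition wreath_pfun w f : pfun n T :=
  [ffun i => omap (A (wcoord w ((wperm w)^-1 i))) (f ((wperm w)^-1 i))].

Lemma wreath_pfunE w f j :
  wreath_pfun w f (wperm w j) = omap (A (wcoord w j)) (f j).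
Proof. by rewrite ffunE /= permK. Qed.

Lemma wreath_pfun1 f : wreath_pfun 1 f = f.
Proof.
apply/ffunP=> i; rewrite ffunE /= invg1 perm1 ffunE.
by case: (f i) => //= x; rewrite lact1.
Qed.

Lemma wreath_pfunM v w f :
  wreath_pfun (v * w) f = wreath_pfun v (wreath_pfun w f).
Proof.
apply/ffunP=> i; rewrite [LHS]ffunE [RHS]ffunE [in RHS]ffunE.
rewrite wpermM wcoordM invMg permM permKV.
by case: (f _) => //= x; rewrite lactM.
Qed.

Lemma pdom_wreath w f : pdom (wreath_pfun w f) = wperm w @: pdom f.
Proof.
apply/setP=> i; rewrite -[i](permKV (wperm w)) mem_imset; last exact: perm_inj.
by rewrite !inE wreath_pfunE; case: (f _).
Qed.

End WreathPfun.

Section Colorings.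
Variables (n : nat) (gT : finGroupType).
Implicit Types (b : pfun n gT) (B : {set 'I_n}).

Definition color_mul b (g : gT) : pfun n gT :=
  [ffun j => omap (fun a => a * g) (b j)].

Lemma color_mul1 : color_mul^~ 1 =1 id.
Proof.
by move=> b; apply/ffunP=> j; rewrite ffunE; case: (b j) => //= x; rewrite mulg1.
Qed.

Lemma color_mulM b : act_morph color_mul b.
Proof.
move=> g h; apply/ffunP=> j; rewrite !ffunE.
by case: (b j) => //= x; rewrite mulgA.
Qed.

Definition color_action : {action gT &-> pfun n gT} :=
  TotalAction color_mul1 color_mulM.

Definition proj_class b : {set pfun n gT} :=
  orbit color_action [set: gT] b.

Definition proj_colorings B : {set {set pfun n gT}} :=
  [set proj_class b | b in [set b : pfun n gT | pdom b == B]].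

Lemma wreath_color_mul (w : wreath n gT) b g :
  wreath_pfun (mulg_laction gT) w (color_mul b g) =
  color_mul (wreath_pfun (mulg_laction gT) w b) g.
Proof.
apply/ffunP=> i; rewrite !ffunE.
by case: (b _) => //= x; rewrite mulgA.
Qed.

Definition wreath_class (w : wreath n gT) (c : {set pfun n gT}) :=
  wreath_pfun (mulg_laction gT) w @: c.

Lemma wreath_proj_class w b :
  wreath_class w (proj_class b) =
  proj_class (wreath_pfun (mulg_laction gT) w b).
Proof.
rewrite /wreath_class /proj_class /orbit -imset_comp.
by apply: eq_imset => g /=; rewrite wreath_color_mul.
Qed.

Lemma wreath_proj_colorings w B c :
  c \in proj_colorings B -> wreath_class w c \in proj_colorings (wperm w @: B).
Proof.
case/imsetP=> b; rewrite inE => /eqP <- ->; rewrite wreath_proj_class.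
by apply: imset_f; rewrite inE pdom_wreath.
Qed.

End Colorings.

(* The second component assigns to every block its projectivized coloring; it
   is set to set0 outside the blocks, so that equality of partial G-partitions
   is Leibniz equality. *)
Definition is_gpartition (n : nat) (gT : finGroupType)
    (p : {set {set 'I_n}} * {ffun {set 'I_n} -> {set pfun n gT}}) : bool :=
  partition p.1 (cover p.1) &&
  [forall B : {set 'I_n},
     if B \in p.1 then p.2 B \in proj_colorings gT B else p.2 B == set0].

Record gpartition (n : nat) (gT : finGroupType) := GPartition {
  gpval : {set {set 'I_n}} * {ffun {set 'I_n} -> {set pfun n gT}};
  gpvalP : is_gpartition gpval }.

HB.instance Definition _ (n : nat) (gT : finGroupType) :=
  [isSub for @gpval n gT].
HB.instance Definition _ (n : nat) (gT : finGroupType) :=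
  [Finite of gpartition n gT by <:].

Section GPartition.
Variables (n : nat) (gT : finGroupType).
Implicit Types (p : gpartition n gT) (w : wreath n gT).

Definition blocks p : {set {set 'I_n}} := (gpval p).1.
Definition block_color p (B : {set 'I_n}) : {set pfun n gT} := (gpval p).2 B.
Definition zero_block p : {set 'I_n} := ~: cover (blocks p).

Definition perm_blocks (s : 'S_n) (P : {set {set 'I_n}}) :=
  [set s @: (B : {set 'I_n}) | B in P].

Lemma imset_perm1 (B : {set 'I_n}) : (1 : 'S_n) @: B = B.
Proof. by rewrite -[RHS]imset_id; apply: eq_imset => i; rewrite perm1. Qed.

Lemma imset_permM (s t : 'S_n) (B : {set 'I_n}) : (s * t) @: B = t @: (s @: B).
Proof. by rewrite -imset_comp; apply: eq_imset => i; rewrite permM. Qed.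

Lemma cover_perm_blocks (s : 'S_n) P :
  cover (perm_blocks s P) = s @: cover P.
Proof.
apply/setP=> i; apply/bigcupP/imsetP.
  case=> C /imsetP[B PB ->] /imsetP[j Bj ->]; exists j => //.
  by apply/bigcupP; exists B.
case=> j /bigcupP[B PB Bj] ->; exists (s @: B); first exact: imset_f.
exact: imset_f.
Qed.

Definition wreath_gpval w
    (p : {set {set 'I_n}} * {ffun {set 'I_n} -> {set pfun n gT}}) :=
  (perm_blocks (wperm w) p.1,
   [ffun C : {set 'I_n} => wreath_class w (p.2 ((wperm w)^-1 @: C))]).

Lemma wreath_gpvalP w p : is_gpartition (wreath_gpval w (gpval p)).
Proof.
case: p => [[P c] /= /andP[/= /and3P[_ tP P0] /forallP cP]].
set s := wperm w; have injs : injective [eta s] by exact: perm_inj.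
have sK (C : {set 'I_n}) : s @: (s^-1 @: C) = C by rewrite -imset_permM mulVg imset_perm1.
have Ks (C : {set 'I_n}) : s^-1 @: (s @: C) = C by rewrite -imset_permM mulgV imset_perm1.
apply/andP; split.
  apply/and3P; split=> //=.
    apply/trivIsetP=> _ _ /imsetP[B PB ->] /imsetP[C PC ->] neqBC.
    have{}neqBC : B != C by apply: contraNneq neqBC => ->.
    by rewrite (imset_disjoint injs) (trivIsetP tP).
  by apply: contra P0 => /imsetP[B PB /esym/eqP]; rewrite imset_eq0 => /eqP<-.
apply/forallP=> C /=; rewrite ffunE /=; have := cP (s^-1 @: C).
have -> : (C \in perm_blocks s P) = ((s^-1 @: C) \in P).
  apply/idP/idP => [/imsetP[B PB ->] | PB]; first by rewrite Ks.
  apply/imsetP.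
  by exists (s^-1 @: C); rewrite ?sK.
case: ifP => /= _; first by move/(wreath_proj_colorings w); rewrite sK.
by move/eqP->; rewrite /wreath_class imset0.
Qed.

Definition wreath_gpartition w p : gpartition n gT :=
  GPartition (wreath_gpvalP w p).

Lemma wreath_gpartition1 p : wreath_gpartition 1 p = p.
Proof.
apply: val_inj; case: p => [[P c]] /= _; congr (_, _).
  rewrite -[RHS]imset_id; apply: eq_imset => B; exact: imset_perm1.
apply/ffunP=> C; rewrite ffunE /= invg1 imset_perm1 -[RHS]imset_id.
by apply: eq_imset => b; rewrite wreath_pfun1.
Qed.

Lemma wreath_gpartitionM v w p :
  wreath_gpartition (v * w) p = wreath_gpartition v (wreath_gpartition w p).
Proof.
apply: val_inj; case: p => [[P c]] /= _; congr (_, _).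
  rewrite /perm_blocks /= -imset_comp; apply: eq_imset => B.
  exact: imset_permM.
apply/ffunP=> C; rewrite !ffunE /= invMg imset_permM /wreath_class -[RHS]imset_comp.
by apply: eq_imset => b; rewrite wreath_pfunM.
Qed.

End GPartition.

Record dset (n : nat) (gT : finGroupType) (S : finType) := DPair {
  dpair_val :> gpartition n gT * pfun n S;
  dpairP : pdom dpair_val.2 == zero_block dpair_val.1 }.

HB.instance Definition _ (n : nat) (gT : finGroupType) (S : finType) :=
  [isSub for @dpair_val n gT S].
HB.instance Definition _ (n : nat) (gT : finGroupType) (S : finType) :=
  [Finite of dset n gT S by <:].

Section WreathAction.
Variables (n : nat) (gT : finGroupType) (S : finType) (A : left_action gT S).
Implicit Types (x : dset n gT S) (w : wreath n gT).

Lemma wreath_dpairP w x :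
  pdom (wreath_pfun A w x.2) == zero_block (wreath_gpartition w x.1).
Proof.
case: x => [[p z]] /= /eqP Dz; rewrite pdom_wreath Dz /zero_block.
rewrite cover_perm_blocks eq_sym; apply/eqP/setP=> i.
rewrite -[i](permKV (wperm w)) inE !mem_imset ?inE //; exact: perm_inj.
Qed.

Definition wreath_dpair w x : dset n gT S :=
  @DPair n gT S (wreath_gpartition w x.1, wreath_pfun A w x.2)
    (wreath_dpairP w x).

Lemma wreath_dpair1 x : wreath_dpair 1 x = x.
Proof.
apply: val_inj; case: x => [[p z]] /= _.
by rewrite wreath_gpartition1 wreath_pfun1.
Qed.

Lemma wreath_dpairM v w x :
  wreath_dpair (v * w) x = wreath_dpair v (wreath_dpair w x).
Proof.
apply: val_inj; case: x => [[p z]] /= _.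
by rewrite wreath_gpartitionM wreath_pfunM.
Qed.

Definition wreath_action : left_action (wreath n gT) (dset n gT S) :=
  LeftAction wreath_dpair1 wreath_dpairM.

End WreathAction.

Definition is_labeled_partition (n : nat) (O : finType)
    (p : seq nat * {ffun O -> nat}) : bool :=
  [&& sorted geq p.1, all (leq 1) p.1
    & sumn p.1 + \sum_(o : O) p.2 o == n]%N.

Record labeled_partition (n : nat) (O : finType) := LabeledPartition {
  lp_val : seq nat * {ffun O -> nat};
  lp_valP : is_labeled_partition n lp_val }.

HB.instance Definition _ (n : nat) (O : finType) :=
  [isSub for @lp_val n O].
HB.instance Definition _ (n : nat) (O : finType) :=
  [Countable of labeled_partition n O by <:].

Section Projection.
Variables (n : nat) (gT : finGroupType) (S : finType) (A : left_action gT S).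
Implicit Types x : dset n gT S.

Definition block_sizes x : seq nat :=
  sort geq [seq #|B| | B : {set 'I_n} <- enum (blocks x.1)].

Definition orbit_counts x : {ffun orbit_type A -> nat} :=
  [ffun o => #|ppreim x.2 (val o)|].

Lemma sum_orbit_counts x :
  (\sum_o orbit_counts x o = #|zero_block x.1|)%N.
Proof.
rewrite -(eqP (dpairP x)); set z := x.2; rewrite -sum1_card.
under eq_bigr do rewrite ffunE -sum1_card.
rewrite (exchange_big_dep (mem (pdom z))) /=; last first.
  by move=> o j _; rewrite !inE; case: (z j).
apply: eq_bigr => j; rewrite inE; case Dz: (z j) => [s|] // _.
have Os : orbit (right_of_left A) [set: gT] s \in lorbits A.
  by apply: imset_f.
rewrite (eq_bigl (pred1 (exist (fun o => o \in lorbits A) _ Os : orbit_type A))) ?big_pred1_eq // => o.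
rewrite inE Dz /= -(inj_eq val_inj) /= eq_sym.
case: o => _ /= /imsetP[t _ ->]; exact/esym/orbit_eq_mem.
Qed.

Lemma pi_subproof x : is_labeled_partition n (block_sizes x, orbit_counts x).
Proof.
have pP : partition (blocks x.1) (cover (blocks x.1)).
  by case/andP: (gpvalP x.1).
apply/and3P; split=> /=.
- by apply: sort_sorted => i j; apply: leq_total.
- rewrite all_sort; apply/allP=> _ /mapP[B PB ->]; rewrite card_gt0.
  by case/and3P: pP => _ _; apply: contraNneq => <-; rewrite -mem_enum.
rewrite sum_orbit_counts (perm_sumn (permEl (perm_sort _ _))).
rewrite sumnE big_map big_enum /= -(card_partition pP).
by rewrite cardsC card_ord.
Qed.

Definition pi_map x : labeled_partition n (orbit_type A) :=
  LabeledPartition (pi_subproof x).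

End Projection.

(* Main.v *)
Require Import Defs.
From HB Require Import structures.
From mathcomp Require Import all_boot all_fingroup.

Set Implicit Arguments.
Unset Strict Implicit.
Unset Printing Implicit Defensive.

Local Open Scope group_scope.

(* Sort the blocks by decreasing size and give each point of [n] a type: the
   index of its block, or the orbit of its image under z. The image under pi_n
   records exactly how many points have each type, so two pairs with the same
   image have types that differ by a permutation s. Such an s matches blocks and
   zero blocks; the G-coordinates of a wreath element over s can then be chosen
   point by point, as G is transitive on itself and on each orbit of S.
   Surjectivity follows by prescribing the types. *)

(** * Orbits and multiplicities in sequences *)

Lemma mem_lorbits (gT : finGroupType) (T : finType) (A : left_action gT T) x :
  orbit (right_of_left A) [set: gT] x \in lorbits A.
Proof. exact: imset_f. Qed.

Lemma count_mktuple (n : nat) (T : eqType) (t : 'I_n -> T) a :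
  count_mem a [tuple t j | j < n] = #|[set j | t j == a]|.
Proof.
rewrite /= count_map cardE {2}/enum_mem size_filter -enumT.
by apply: eq_count => j /=; rewrite inE.
Qed.

(** As [h] is injective, [h k] occurs only in the run of index [k], and [uniq r] allows one such run
    at most. *)
Lemma count_flatten_nseq (I T : eqType) (r : seq I) (h : I -> T) m k :
  uniq r -> injective h ->
  count_mem (h k) (flatten [seq nseq (m i) (h i) | i <- r]) =
    if k \in r then m k else 0%N.
Proof.
move=> + injh; elim: r => //= i r IHr /andP[nri /IHr{}IHr].
rewrite count_cat count_nseq {}IHr /= (inj_eq injh) inE eq_sym.
by case: eqP nri => [-> | _] nri /=; rewrite ?mul0n ?mul1n ?(negbTE nri) ?addn0.
Qed.

(** * Complete orbit invariants: surjective maps whose fibers are the orbits *)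

Section OrbitInvariant.
Variables (gT : finGroupType) (T : finType) (A : left_action gT T).
Variables (P : eqType) (f : T -> P).
Hypothesis orbit_f :
  forall x y, (y \in orbit (right_of_left A) [set: gT] x) = (f y == f x).
Hypothesis f_surj : forall p, exists x, f x = p.

Lemma orbitE_fiber x :
  orbit (right_of_left A) [set: gT] x = [set y | f y == f x].
Proof. by apply/setP=> y; rewrite orbit_f inE. Qed.

Lemma lorbits_fiberP (X : {set T}) :
  X \in lorbits A <-> exists p, X = [set x | f x == p].
Proof.
split=> [/imsetP[x _ ->] | [p ->]]; first by exists (f x); apply: orbitE_fiber.
by have [x <-] := f_surj p; rewrite -orbitE_fiber; apply: imset_f.
Qed.

(** [F] evaluates [f] at a chosen point of each orbit, and [orbit_f] makes the choice immaterial;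
    the inverse sends [p] to the orbit of any preimage. *)
Lemma orbit_type_bijection :
  exists F : orbit_type A -> P,
    bijective F /\ forall (X : orbit_type A) x, x \in val X -> F X = f x.
Proof.
have XP (X : orbit_type A) : {x | orbit (right_of_left A) [set: gT] x == val X}.
  by apply: sigW; case: X => _ /= /imsetP[x _ ->]; exists x.
pose F X := f (sval (XP X)).
have FE (X : orbit_type A) x : x \in val X -> F X = f x.
  by rewrite /F; case: (XP X) => y /= /eqP <-; rewrite orbit_f => /eqP.
have pX p : {x | f x == p}.
  by apply: sigW; have [x <-] := f_surj p; exists x.
pose o x : orbit_type A := exist (fun X => X \in lorbits A) _ (mem_lorbits A x).
exists F; split=> //; exists (fun p => o (sval (pX p))) => [X | p].
  case: (pX (F X)) => x /= /eqP fx; apply: val_inj => /=.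
  move: fx; rewrite /F; case: (XP X) => y /= /eqP <- fx.
  by rewrite !orbitE_fiber fx.
by case: (pX p) => x /= /eqP <-; apply: FE; apply: orbit_refl.
Qed.

End OrbitInvariant.

(** * Invariance of block sizes and orbit counts under the wreath product *)

Section Invariant.
Variables (n : nat) (gT : finGroupType) (S : finType) (A : left_action gT S).
Implicit Types (x y : dset n gT S) (w : wreath n gT) (B C : {set 'I_n}).

Lemma trivIset_blocks (p : gpartition n gT) : trivIset (blocks p).
Proof. by case/andP: (gpvalP p) => /and3P[]. Qed.

Lemma block_sizes_wreath w x :
  block_sizes (wreath_dpair A w x) = block_sizes x.
Proof.
apply/perm_sortP; rewrite /=.
- by move=> i j; apply: leq_total.
- by move=> i j k /= ji ik; apply: leq_trans ik ji.
- by move=> i j /= /anti_leq.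
have injs : injective (fun B => wperm w @: B).
  exact/imset_inj/perm_inj.
have /perm_map/permPl-> :
    perm_eq (enum (blocks (wreath_gpartition w x.1)))
            [seq wperm w @: (B : {set 'I_n}) | B <- enum (blocks x.1)].
  apply: uniq_perm; rewrite ?enum_uniq ?(map_inj_uniq injs) ?enum_uniq //.
  move=> C; rewrite mem_enum; apply/imsetP/mapP.
    by case=> B PB ->; exists B; rewrite ?mem_enum.
  by case=> B PB ->; exists B => //; rewrite -mem_enum.
have cardw B : #|wperm w @: B| = #|B| by rewrite card_imset //; apply: perm_inj.
by rewrite -map_comp (eq_map cardw).
Qed.

Definition orbit_of (s : S) : orbit_type A :=
  exist (fun X => X \in lorbits A) (orbit (right_of_left A) [set: gT] s)
    (mem_lorbits A s).

Lemma orbit_of_eq s (o : orbit_type A) : (orbit_of s == o) = (s \in val o).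
Proof.
rewrite -(inj_eq val_inj) /=; case: o => _ /= /imsetP[t _ ->].
exact: orbit_eq_mem.
Qed.

Lemma orbit_of_lact a s : orbit_of (A a s) = orbit_of s.
Proof. by apply/eqP; rewrite orbit_of_eq; apply/lorbitP; exists a. Qed.

Lemma orbit_of_repr (o : orbit_type A) : exists s, orbit_of s == o.
Proof.
case: o => X oX; case/imsetP: (oX) => s _ Xs.
by exists s; rewrite orbit_of_eq /= Xs; apply: orbit_refl.
Qed.

Lemma mem_ppreim (f : pfun n S) (o : orbit_type A) j :
  (j \in ppreim f (val o)) = (omap orbit_of (f j) == Some o).
Proof. by rewrite inE; case: (f j) => //= s; rewrite -orbit_of_eq. Qed.

Lemma orbit_counts_wreath w x :
  orbit_counts A (wreath_dpair A w x) = orbit_counts A x.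
Proof.
apply/ffunP=> o; rewrite !ffunE.
rewrite -[RHS](card_imset _ (@perm_inj _ (wperm w))); congr #|pred_of_set _|.
apply/setP=> i; rewrite -[i](permKV (wperm w)) mem_imset; last exact: perm_inj.
rewrite !mem_ppreim wreath_pfunE; case: (x.2 _) => //= s.
by rewrite orbit_of_lact.
Qed.

Lemma pi_map_wreath w x : pi_map A (wreath_dpair A w x) = pi_map A x.
Proof.
by apply: val_inj; rewrite /= block_sizes_wreath orbit_counts_wreath.
Qed.

(** * Types of points: index of the block, or orbit of the label *)

Definition sorted_blocks x : seq {set 'I_n} :=
  sort (relpre (fun B => #|B|) geq) (enum (blocks x.1)).

Lemma mem_sorted_blocks x B : (B \in sorted_blocks x) = (B \in blocks x.1).
Proof. by rewrite mem_sort mem_enum. Qed.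

(** Sorting commutes with taking sizes, so the index of a block is also the position of its size in
    [block_sizes]. *)
Lemma card_sorted_blocks x :
  [seq #|B| | B : {set 'I_n} <- sorted_blocks x] = block_sizes x.
Proof. by rewrite /block_sizes sort_map. Qed.

Lemma zero_blockE x j : (j \in cover (blocks x.1)) = ~~ x.2 j.
Proof.
have /eqP/setP/(_ j) := dpairP x; rewrite !inE.
by case: (j \in _); case: (x.2 j).
Qed.

Definition point_type x j : nat + orbit_type A :=
  if x.2 j is Some s then inr (orbit_of s)
  else inl (find (fun B => j \in B) (sorted_blocks x)).

(** This holds for every [i]: past the last block the right side is the default [set0], and no point
    has such a type. *)
Lemma point_type_inl x j i :
  (point_type x j == inl i) = (j \in nth set0 (sorted_blocks x) i).
Proof.
rewrite /point_type; set bl := sorted_blocks x.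
have blP k : (k < size bl)%N -> nth set0 bl k \in blocks x.1.
  by move=> lt_k; rewrite -mem_sorted_blocks mem_nth.
have := zero_blockE x j; case: (x.2 j) => [s | ] cj.
  case: (ltnP i (size bl)) => [/blP Bi | le_i]; last by rewrite nth_default ?inE.
  apply/esym/negbTE; apply: contraFN cj => ji; 
    by apply/bigcupP; exists (nth set0 bl i).
have hasj : has (fun B => j \in B) bl.
  case/bigcupP: cj => B PB jB; apply/hasP; exists B => //.
  by rewrite mem_sorted_blocks.
have jf := nth_find set0 hasj; apply/eqP/idP => [[<-] // | ji].
congr inl; have lt_i : (i < size bl)%N.
  by rewrite ltnNge; apply/negP=> le_i; rewrite nth_default ?inE in ji.
(* Both indices point to a block containing [j], hence to the same block; the list has no
   repetition, so they agree. *)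
apply/eqP; rewrite -(nth_uniq set0 _ lt_i) -?has_find //; last first.
  by rewrite sort_uniq enum_uniq.
have tP := trivIset_blocks x.1.
rewrite -(def_pblock tP (blP _ lt_i) ji).
by rewrite -(def_pblock tP (blP _ _) jf) // -has_find.
Qed.

Lemma point_type_inr x j o :
  (point_type x j == inr o) = (j \in ppreim x.2 (val o)).
Proof. by rewrite mem_ppreim /point_type; case: (x.2 j). Qed.

(** The multiplicities of the types are thus read off [pi_map A x]; the default size 0 is the
    cardinal of the default block [set0]. *)
Lemma count_point_type x t :
  count_mem t [tuple point_type x j | j < n] =
    match t with
    | inl i => nth 0%N (block_sizes x) i
    | inr o => orbit_counts A x o
    end.
Proof.
rewrite count_mktuple; case: t => [i | o]; last first.
  by rewrite ffunE; apply: eq_card => j; rewrite inE point_type_inr.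
rewrite -card_sorted_blocks (eq_card (B := nth set0 (sorted_blocks x) i)).
  case: (ltnP i (size (sorted_blocks x))) => lt_i; first by rewrite (nth_map set0).
  by rewrite !nth_default ?size_map ?cards0.
by move=> j; rewrite inE point_type_inl.
Qed.

(** Two tuples in which every type has the same multiplicity differ by a permutation of the
    indices. *)
Lemma pi_map_point_type x y :
  pi_map A x = pi_map A y ->
  exists s : 'S_n, forall j, point_type y (s j) = point_type x j.
Proof.
move=> /(congr1 val) [eq_b eq_o].
have /tuple_permP[s Ds] : perm_eq [tuple point_type x j | j < n]
                       [tuple point_type y j | j < n].
  apply/allP=> t _ /=; rewrite !count_point_type eq_b.
  by case: t => // o; rewrite eq_o.
exists s => j; have/(congr1 (fun u => nth (point_type x j) u j)) := Ds.
by rewrite -!tnth_nth !tnth_mktuple.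
Qed.

(** * Representatives of projectivized colorings *)

Definition color_rep (p : gpartition n gT) B : pfun n gT :=
  odflt [ffun=> None]
    [pick b | (pdom b == B) && (block_color p B == proj_class b)].

(** On a block the search in [color_rep] succeeds because the color lies in [proj_colorings]; its
    empty default only serves off the blocks. *)
Lemma color_repP (p : gpartition n gT) B : B \in blocks p ->
  pdom (color_rep p B) = B /\ block_color p B = proj_class (color_rep p B).
Proof.
case/andP: (gpvalP p) => _ /forallP/(_ B) pB PB; move: pB; rewrite PB.
case/imsetP=> b; rewrite inE => domb pBb; rewrite /color_rep.
case: pickP => /= [c /andP[/eqP-> /eqP] // | /(_ b)].
by rewrite domb -pBb eqxx.
Qed.

(** The chosen colorings of the disjoint blocks, glued into one function on [n], with value 1 on the
    zero block. *)
Definition point_color (p : gpartition n gT) j : gT :=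
  odflt 1 (color_rep p (pblock (blocks p) j) j).

Lemma color_repE (p : gpartition n gT) B j : B \in blocks p ->
  color_rep p B j = if j \in B then Some (point_color p j) else None.
Proof.
move=> PB; have [/setP/(_ j) + _] := color_repP PB; rewrite inE /point_color.
case: ifP => [jB | _]; last by case: (color_rep p B j).
by rewrite (def_pblock (trivIset_blocks p) PB jB); case: (color_rep p B j).
Qed.

(** * A wreath element over a type-preserving permutation *)

Section Transport.
Variables (x y : dset n gT S) (s : 'S_n).
Hypothesis size_xy : size (sorted_blocks x) = size (sorted_blocks y).
Hypothesis type_xy : forall j, point_type y (s j) = point_type x j.

(** On a block, $b'(s(j)) = g_j b(j)$ forces this quotient of colors. On the zero block any element
    moving one label to the other will do. Equality of types excludes the mixed cases. *)
Definition transport_coord j : gT :=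
  match x.2 j, y.2 (s j) with
  | Some a, Some b => odflt 1 [pick g | A g a == b]
  | _, _ => point_color y.1 (s j) * (point_color x.1 j)^-1
  end.

Definition transport : wreath n gT := Wreath [ffun j => transport_coord j] s.

(** Both sides consist of the points of type [inl i] for [y]. *)
Lemma imset_sorted_blocks i :
  s @: nth set0 (sorted_blocks x) i = nth set0 (sorted_blocks y) i.
Proof.
apply/setP=> k; rewrite -[k](permKV s) mem_imset; last exact: perm_inj.
by rewrite -!point_type_inl type_xy.
Qed.

Lemma blocks_transport B : (s @: B \in blocks y.1) = (B \in blocks x.1).
Proof.
rewrite -!mem_sorted_blocks.
apply/(nthP set0)/(nthP set0) => -[i lt_i Di]; exists i.
- by rewrite size_xy.
- by apply: (imset_inj (@perm_inj _ s)); rewrite imset_sorted_blocks.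
- by rewrite -size_xy.
- by rewrite -imset_sorted_blocks Di.
Qed.

Lemma transport_pfun : wreath_pfun A transport x.2 = y.2.
Proof.
apply/ffunP=> i; rewrite -[i](permKV s); move: (s^-1 i) => j.
rewrite [LHS](wreath_pfunE A transport) /= ffunE /transport_coord.
have /eqP := type_xy j; rewrite /point_type.
case: (x.2 j) (y.2 (s j)) => [a|] [b|] //=.
(* Equal types put [a] and [b] in one orbit, so the search for a group element cannot fail. *)
rewrite [_ == _]orbit_of_eq => /lorbitP[g Agab].
by case: pickP => [h /eqP-> // | /(_ g)]; rewrite Agab eqxx.
Qed.

(** The coordinates were chosen to carry the representative coloring of [B] exactly to that of its
    image, so the classes agree. *)
Lemma transport_class B : B \in blocks x.1 ->
  wreath_class transport (block_color x.1 B) = block_color y.1 (s @: B).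
Proof.
move=> xB; have yB : s @: B \in blocks y.1 by rewrite blocks_transport.
have [_ ->] := color_repP xB; have [_ ->] := color_repP yB.
rewrite wreath_proj_class; congr proj_class.
apply/ffunP=> i; rewrite -[i](permKV s); move: (s^-1 i) => j.
rewrite [LHS](wreath_pfunE _ transport) /= ffunE /transport_coord.
rewrite !color_repE // mem_imset; last exact: perm_inj.
case: ifP => // jB /=.
have : j \in cover (blocks x.1) by apply/bigcupP; exists B.
by rewrite zero_blockE; case: (x.2 j) => //= _; rewrite mulgKV.
Qed.

Lemma transport_blocks : perm_blocks s (blocks x.1) = blocks y.1.
Proof.
apply/setP=> C; apply/imsetP/idP => [[B xB ->] | yC].
  by rewrite blocks_transport.
by exists (s^-1 @: C); rewrite -?blocks_transport -imset_permM mulVg imset_perm1.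
Qed.

Lemma transport_gpartition : wreath_gpartition transport x.1 = y.1.
Proof.
apply: val_inj; rewrite /= [RHS]surjective_pairing; congr (_, _).
  exact: transport_blocks.
apply/ffunP=> C; rewrite ffunE /=.
have sKC : s @: (s^-1 @: C) = C by rewrite -imset_permM mulVg imset_perm1.
have [yC | nyC] := boolP (C \in blocks y.1).
  by rewrite [LHS]transport_class ?sKC // -blocks_transport sKC.
(* Equality is also due off the blocks, where both color functions are [set0]. *)
have color0 (p : gpartition n gT) B : B \notin blocks p -> (gpval p).2 B = set0.
  case/andP: (gpvalP p) => _ /forallP/(_ B) + /negbTE nB.
  by rewrite nB => /eqP.
by rewrite !color0 ?/wreath_class ?imset0 // -blocks_transport sKC.
Qed.

Lemma transportE : wreath_dpair A transport x = y.
Proof.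
apply: val_inj; rewrite /= transport_gpartition transport_pfun.
by case: (dpair_val y).
Qed.

End Transport.

Lemma pi_map_orbit x y :
  (y \in orbit (right_of_left (wreath_action n A)) [set: wreath n gT] x) =
  (pi_map A y == pi_map A x).
Proof.
apply/lorbitP/eqP => [[w <-] | /esym pi_xy]; first exact: pi_map_wreath.
have [s type_xy] := pi_map_point_type pi_xy.
exists (transport x y s); apply: transportE type_xy.
(* What remains is [size_xy]: equal lists of sizes have equal lengths. *)
have /(congr1 val) [/(congr1 size)] := pi_xy.
by rewrite -!card_sorted_blocks !size_map.
Qed.

(** * Surjectivity: a pair with prescribed type multiplicities *)

Section Realization.
Variable p : labeled_partition n (orbit_type A).
Let parts := (lp_val p).1.
Let labels := (lp_val p).2.

(** List each type as often as prescribed. The parts and labels sum to [n], so the list is an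
    [n]-tuple, that is, a typing of [n]. *)
Lemma exists_typing :
  exists t : 'I_n -> nat + orbit_type A,
    (forall i, #|[set j | t j == inl i]| = nth 0%N parts i) /\
    (forall o, #|[set j | t j == inr o]| = labels o).
Proof.
pose inl' := @inl nat (orbit_type A); pose inr' := @inr nat (orbit_type A).
pose tl := flatten [seq nseq (nth 0%N parts i) (inl' i) | i <- iota 0 (size parts)].
pose tr := flatten [seq nseq (labels o) (inr' o) | o <- enum (orbit_type A)].
have [_ _ /eqP sum_p] := and3P (lp_valP p).
have size_t : size (tl ++ tr) == n.
  rewrite size_cat !size_flatten /shape -!map_comp.
  rewrite !(eq_map (fun i => size_nseq _ _)) -/(mkseq _ _) mkseq_nth.
  by rewrite [X in (_ + X)%N]sumnE big_map -enumT big_enum sum_p.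
pose T := Tuple size_t.
have countT a : #|[set j | tnth T j == a]| = count_mem a (tl ++ tr).
  by rewrite -count_mktuple /= map_tnth_enum.
have inl_inj : injective inl' by move=> ? ? [].
have inr_inj : injective inr' by move=> ? ? [].
have notin_tl o : inr o \notin tl.
  by apply/negP=> /flatten_mapP[i _ /nseqP[]].
have notin_tr i : inl i \notin tr.
  by apply/negP=> /flatten_mapP[o _ /nseqP[]].
exists (tnth T); split=> [i | o]; rewrite countT count_cat.
  rewrite (count_flatten_nseq _ _ (iota_uniq _ _) inl_inj) mem_iota /=.
  rewrite (count_memPn (notin_tr i)) addn0.
  by case: ltnP => // le_i; rewrite nth_default.
rewrite (count_flatten_nseq _ _ (enum_uniq _) inr_inj) mem_enum.
by rewrite (count_memPn (notin_tl o)).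
Qed.

Lemma pi_map_surj : exists x, pi_map A x = p.
Proof.
have [t [card_inl card_inr]] := exists_typing.
have [sorted_p /allP pos_p _] := and3P (lp_valP p).
pose block i := [set j | t j == inl i].
pose P : {set {set 'I_n}} := [set B in mkseq block (size parts)].
(* Past the end of [parts] the default size is 0, so no point has such an index. *)
have block_lt i j : t j = inl i -> (i < size parts)%N.
  move=> tj; rewrite ltnNge; apply/negP=> le_i.
  have /eqP := card_inl i; rewrite nth_default // cards_eq0 => /eqP/setP/(_ j).
  by rewrite !inE tj eqxx.
have PP B : B \in P -> exists2 i, (i < size parts)%N & B = block i.
  by rewrite inE => /mapP[i]; rewrite mem_iota => ? ->; exists i.
have block_neq0 i : (i < size parts)%N -> block i != set0.
  by move=> lt_i; rewrite -card_gt0 card_inl; apply/pos_p/mem_nth.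
have cover_P j : (j \in cover P) = if t j is inl _ then true else false.
  apply/bigcupP/idP => [[_ /PP[i _ ->]] | ].
    by rewrite inE => /eqP->.
  case tj: (t j) => [i|] // _; exists (block i); last by rewrite inE tj.
  by rewrite inE map_f // mem_iota /=; apply: block_lt tj.
have partP : partition P (cover P).
  apply/and3P; split=> //.
    apply/trivIsetP=> _ _ /PP[i _ ->] /PP[k _ ->]; apply: contraR.
    case/pred0Pn=> j /=; rewrite !inE => /andP[/eqP-> /eqP[->]].
    exact: eqxx.
  by apply/negP=> /PP[i /block_neq0/eqP + Bi]; rewrite -Bi.
(* Any coloring of the blocks would do; the constant 1 is taken. *)
pose unit_color B : pfun n gT := [ffun j => if j \in B then Some 1 else None].
pose c := [ffun B => if B \in P then proj_class (unit_color B) else set0].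
have gpP : is_gpartition (P, c).
  apply/andP; split=> //; apply/forallP=> B /=; rewrite ffunE.
  case: (B \in P) => //; apply/imsetP; exists (unit_color B) => //; rewrite inE.
  by apply/eqP/setP=> j; rewrite inE ffunE; case: ifP.
pose z : pfun n S := [ffun j =>
  if t j is inr o then [pick s | orbit_of s == o] else None].
have orbit_z j : omap orbit_of (z j) = if t j is inr o then Some o else None.
  rewrite ffunE; case: (t j) => // o; case: pickP => [s /eqP <- // | noS].
  by have [s] := orbit_of_repr o; rewrite noS.
have zP : pdom z == zero_block (GPartition gpP).
  apply/eqP/setP=> j; rewrite in_setC cover_P inE.
  by move: (orbit_z j); case: (z j) (t j) => [?|] [].
exists (@DPair n gT S (GPartition gpP, z) zP); apply: val_inj => /=.
rewrite [RHS]surjective_pairing; congr (_, _); last first.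
  apply/ffunP=> o; rewrite ffunE /= -card_inr; apply: eq_card => j.
  by rewrite mem_ppreim orbit_z inE; case: (t j).
rewrite /block_sizes /blocks /=.
(* Sorted lists with the same multiset of entries are equal, so the order in which [enum] lists the
   blocks is irrelevant. *)
apply: (@sorted_eq _ geq) => //.
- by move=> i j k /= ji ik; apply: leq_trans ik ji.
- by move=> i j /= /anti_leq.
- by apply: sort_sorted => i j; apply: leq_total.
rewrite perm_sort -/parts -[X in perm_eq _ X](mkseq_nth 0%N).
have -> : mkseq (nth 0%N parts) (size parts) =
          [seq #|B| | B : {set 'I_n} <- mkseq block (size parts)].
  by rewrite -map_comp; apply: eq_map => i /=; rewrite card_inl.
apply/perm_map/uniq_perm; first exact: enum_uniq.
  rewrite map_inj_in_uniq ?iota_uniq // => i k; rewrite !mem_iota /= => lt_i _.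
  (* A point of the nonempty [block i] has only one type, so distinct indices give distinct
     blocks. *)
  have /set0Pn[j ji] := block_neq0 i lt_i; move/setP/(_ j).
  by move: ji; rewrite !inE => /eqP-> ; rewrite eqxx => /esym/eqP[].
by move=> B; rewrite mem_enum inE.
Qed.

End Realization.

End Invariant.

Theorem theorem2p25 (n : nat) (gT : finGroupType) (S : finType)
    (A : left_action gT S) (hn : (0 < n)%N) :
  (forall p : labeled_partition n (orbit_type A),
     exists x : dset n gT S, pi_map A x = p) /\
  (forall X : {set dset n gT S},
     X \in lorbits (wreath_action n A) <->
     exists p : labeled_partition n (orbit_type A),
       X = [set x | pi_map A x == p]) /\
  (exists f : orbit_type (wreath_action n A) ->
              labeled_partition n (orbit_type A),
     bijective f /\
     forall (X : orbit_type (wreath_action n A)) (x : dset n gT S),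
       x \in val X -> f X = pi_map A x).
Proof.
(* These two facts say that [pi_map A] is a complete orbit invariant; the rest is formal. *)
have surj := @pi_map_surj n gT S A; have orb := @pi_map_orbit n gT S A.
split=> //; split; first exact: lorbits_fiberP orb surj.
exact: orbit_type_bijection orb surj.
Qed.
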